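(* A domain $R$ has the property that every nonzero ideal is $w$-basic if and only if $R$ is a P$v$MD of $t$-dimension $1$ (i.e., every maximal $t$-ideal of $R$ has height one).
   Context: For a domain $R$ with quotient field $K$ and nonzero fractional ideal $I$: $I^{-1}=(R:I)=\{x\in K:xI\subseteq R\}$, $I_v=(I^{-1})^{-1}$, $I_t=\bigcup J_v$ over finitely generated subideals $J\subseteq I$; a maximal $t$-ideal is an ideal maximal among proper integral ideals $Q$ with $Q_t=Q$. The $w$-operation is $I_w=\bigcup(I:J)$ over finitely generated ideals $J$ with $J_v=R$ (equivalently $I_w=\bigcap_M IR_M$ over maximal $t$-ideals $M$). $R$ is a P$v$MD if every nonzero finitely generated ideal $I$ satisfies $(II^{-1})_t=R$ (equivalently $R_M$ is a valuation domain for each maximal $t$-ideal $M$). For a nonzero ideal $I$, an ideal $J\subseteq I$ is a $w$-reduction of $I$ if $(JI^n)_w=(I^{n+1})_w$ for some integer $n\ge0$; $I$ is $w$-basic if every $w$-reduction $J$ of $I$ satisfies $J_w=I_w$. *)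

(* Defs.v *)
From HB Require Import structures.
From mathcomp Require Import all_boot all_order all_algebra fraction.
Set Implicit Arguments. Unset Strict Implicit. Unset Printing Implicit Defensive.
Import GRing.Theory.
Local Open Scope ring_scope.

Section Defs.
Variable R : idomainType.
Local Notation K := {fraction R}.
Local Notation "x %:F" := (@FracField.tofrac R x).

Definition fset := K -> Prop.
Definition subs (A B : fset) := forall x, A x -> B x.
Definition seteq (A B : fset) := forall x, A x <-> B x.

Definition inR : fset := fun x => exists r : R, x = r%:F.

Definition submod (A : fset) :=
  [/\ A 0, (forall x y, A x -> A y -> A (x + y)) & (forall (r : R) x, A x -> A (r%:F * x))].
Definition nonzero (A : fset) := exists x, A x /\ x != 0.

Definition int_ideal (A : fset) := submod A /\ subs A inR.
Definition colon (A B : fset) : fset := fun x => forall b, B b -> A (x * b).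
Definition inv (A : fset) : fset := colon inR A.
Definition vop (A : fset) : fset := inv (inv A).

Definition gen (s : seq K) : fset := fun x =>
  exists c : seq R, size c = size s /\ x = \sum_(i < size s) (nth 0 c i)%:F * nth 0 s i.
Definition fg_ideal (A : fset) := subs A inR /\ exists s : seq K, seteq A (gen s).

Definition prodI (A B : fset) : fset := fun x =>
  exists s : seq (K * K), (forall p, p \in s -> A p.1 /\ B p.2) /\
                          x = \sum_(p <- s) p.1 * p.2.
Fixpoint powI (A : fset) (n : nat) : fset :=
  match n with 0 => inR | n'.+1 => prodI (powI A n') A end.

Definition top (A : fset) : fset := fun x =>
  exists J, [/\ fg_ideal J, nonzero J, subs J A & vop J x].
Definition t_ideal (A : fset) := seteq (top A) A.
Definition proper (A : fset) := ~ seteq A inR.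
Definition maximal_t_ideal (Q : fset) :=
  [/\ int_ideal Q, proper Q, t_ideal Q &
      forall Q', int_ideal Q' -> proper Q' -> t_ideal Q' -> subs Q Q' -> seteq Q Q'].

Definition wop (A : fset) : fset := fun x =>
  exists J, [/\ fg_ideal J, seteq (vop J) inR & colon A J x].

Definition PvMD :=
  forall I, fg_ideal I -> nonzero I -> seteq (top (prodI I (inv I))) inR.

Definition prime_ideal (P : fset) :=
  [/\ int_ideal P, proper P & forall a b : R, P (a * b)%:F -> P a%:F \/ P b%:F].
Definition height_one (P : fset) :=
  [/\ prime_ideal P, nonzero P &
      forall Q, prime_ideal Q -> nonzero Q -> subs Q P -> seteq Q P].

Definition t_dim_one := forall M, maximal_t_ideal M -> height_one M.

Definition w_reduction (J I : fset) :=
  [/\ int_ideal J, subs J I &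
      exists n : nat, seteq (wop (prodI J (powI I n))) (wop (powI I n.+1))].
Definition w_basic (I : fset) :=
  forall J, w_reduction J I -> seteq (wop J) (wop I).

End Defs.

(* Main.v *)
(** For a, b in R write D(a,b) = (aR : b), and call an ideal dense if it contains a
    finitely generated F with F_v = R. R is a PvMD iff D(a,b) + D(b,a) is always dense.

    If all ideals are w-basic, apply this to the reduction (a^2, b^2) of (a, b)^2: it gives
    fab = ra^2 + tb^2 for f in a dense ideal, and tb/a is integral of degree two over R,
    hence in R (use the reduction (a) of (a, b)); so f lies in D(a,b) + D(b,a). If a nonzero
    prime Q were strictly inside a maximal t-ideal M, then for q in Q nonzero, qR_M cap R
    would be a w-reduction of qR_Q cap R, and they differ.

    Conversely let J be a w-reduction of I and a in I outside J_w. The ideal (J : a) is not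
    dense, so Zorn's lemma puts it in a maximal t-ideal M, and R_M is a rank one valuation
    domain in which J is contained in (a). Thus I I^n = J I^n is contained in a I^n, so
    I R_M = aR_M by complete integral closedness, and a^(n+1) in J I^n gives a in J R_M,
    contradicting the inclusion of (J : a) in M. *)

Require Import Defs.
From HB Require Import structures.
From mathcomp Require Import all_boot all_order all_algebra fraction.
From mathcomp Require Import ring boolp classical_sets.
Set Implicit Arguments. Unset Strict Implicit. Unset Printing Implicit Defensive.
Import GRing.Theory Defs.
Local Open Scope ring_scope.

(** * Dense ideals *)

Section PvMD.
Variable R : idomainType.
Local Notation K := {fraction R}.
Local Notation "x %:F" := (@FracField.tofrac R x).
Implicit Types (A B D : R -> Prop) (I J M Q : fset R) (r t : R) (x y z : K).

(* The ideal [F] generated by [s] satisfies [F_v = R]. *)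
Definition gv (s : seq R) := forall z, (forall f, f \in s -> inR (z * f%:F)) -> inR z.
Definition dense A := exists s, (forall f, f \in s -> A f) /\ gv s.

(** Ideals are kept as predicates on R, parallel to [submod] for predicates on K; [trace] and [img]
    pass between the two. *)
Definition ideal A :=
  [/\ A 0, forall r t, A r -> A t -> A (r + t) & forall r t, A t -> A (r * t)].
Definition trace I : R -> Prop := fun r => I r%:F.
Definition colonr I x : R -> Prop := fun r => I (r%:F * x).
(** The conductor (aR : b), that is, D(a,b) of the overview. *)
Definition quo a b : R -> Prop := fun r => exists w, r * b = a * w.
Definition sumi A B : R -> Prop := fun r => exists u v, [/\ A u, B v & r = u + v].

Lemma inR_F r : inR r%:F. Proof. by exists r. Qed.
#[local] Hint Resolve inR_F : core.

Lemma FI : injective (@FracField.tofrac R).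
Proof. by move=> a b /eqP; rewrite tofrac_eq => /eqP. Qed.

Lemma inR_D x y : inR x -> inR y -> inR (x + y).
Proof. by move=> [a ->] [b ->]; exists (a + b); rewrite tofracD. Qed.

Lemma inR_M x y : inR x -> inR y -> inR (x * y).
Proof. by move=> [a ->] [b ->]; exists (a * b); rewrite tofracM. Qed.

Lemma submod0 I : submod I -> I 0. Proof. by case. Qed.
Lemma submodD I x y : submod I -> I x -> I y -> I (x + y).
Proof. by move=> [_ ID _]; apply: ID. Qed.
Lemma submodM I r x : submod I -> I x -> I (r%:F * x).
Proof. by move=> [_ _ IM]; apply: IM. Qed.

Lemma submod_inR : submod (@inR R).
Proof.
split; first by exists 0; rewrite tofrac0.
  exact: inR_D.
by move=> r x; apply: inR_M.
Qed.

Lemma ideal_colonr I x : submod I -> ideal (colonr I x).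
Proof.
move=> [I0 ID IM]; split; rewrite /colonr ?tofrac0 ?mul0r //.
  by move=> r t Ir It; rewrite tofracD mulrDl; apply: ID.
by move=> r t It; rewrite tofracM -mulrA; apply: IM.
Qed.

Lemma ideal_trace I : submod I -> ideal (trace I).
Proof.
move=> [I0 ID IM]; split; rewrite /trace ?tofrac0 //.
  by move=> r t Ir It; rewrite tofracD; apply: ID.
by move=> r t It; rewrite tofracM; apply: IM.
Qed.

Lemma ideal_quo a b : ideal (quo a b).
Proof.
split; first by exists 0; ring.
  by move=> r t [w hw] [w' hw']; exists (w + w'); rewrite mulrDl hw hw' mulrDr.
by move=> r t [w hw]; exists (r * w); rewrite -mulrA hw mulrCA.
Qed.

Lemma dense_sub A B : (forall r, A r -> B r) -> dense A -> dense B.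
Proof. by move=> AB [s [sA gs]]; exists s; split=> // f /sA /AB. Qed.

Lemma dense1 A : A 1 -> dense A.
Proof.
move=> A1; exists [:: 1]; split=> [f|z hz]; first by rewrite inE => /eqP ->.
by rewrite -[z]mulr1 -tofrac1; apply: hz; rewrite inE.
Qed.

(** This is what makes w idempotent. Each of the finitely many f in [s] has a [gv] set s1 with s1 f
    inside A. The union of these products is [gv]: a z that sends all of them into R sends each f
    into R, hence lies in R. *)
Lemma dense_trans A B :
  dense B -> (forall r, B r -> dense (fun t => A (t * r))) -> dense A.
Proof.
move=> [s [sB gs]] BA.
have [s2 [s2A gs2]] : exists s2 : seq R, (forall f, f \in s2 -> A f) /\
    forall z, (forall f, f \in s2 -> inR (z * f%:F)) ->
      forall f, f \in s -> inR (z * f%:F).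
  elim: s sB {gs} => [|f s IHs] sB; first by exists [::].
  have [|s2 [s2A gs2]] := IHs; first by move=> g gs; apply: sB; rewrite inE gs orbT.
  have [s1 [s1A gs1]] := BA f (sB f (mem_head _ _)).
  exists ([seq t * f | t <- s1] ++ s2); split.
    by move=> g; rewrite mem_cat => /orP[/mapP[t /s1A ? ->]|/s2A].
  move=> z hz g; rewrite inE => /orP[/eqP ->|gs].
    apply: gs1 => t ts; rewrite -mulrA [_ * t%:F]mulrC -tofracM; apply: hz.
    by rewrite mem_cat; apply/orP; left; apply/mapP; exists t.
  by apply: gs2 gs => h hs; apply: hz; rewrite mem_cat hs orbT.
exists s2; split=> // z hz; apply: gs; exact: gs2 hz.
Qed.

Lemma ideal_mulr A e : ideal A -> ideal (fun r => A (r * e)).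
Proof.
move=> [A0 AD AM]; split=> [|x y hx hy|x y h]; rewrite ?mul0r // ?mulrDl -?mulrA.
  exact: AD.
exact: AM.
Qed.

Lemma dense_and A B : ideal A -> ideal B -> dense A -> dense B ->
  dense (fun r => A r /\ B r).
Proof.
move=> [_ _ AM] [_ _ BM] dA dB; apply: (dense_trans dA) => r Ar.
by apply: dense_sub dB => t Bt; split; [apply: AM | rewrite mulrC; apply: BM].
Qed.

(** Serves as a case split: once A + B is dense, density of D may be tested after multiplying by an
    element of A and, separately, by one of B. *)
Lemma dense_sumi A B D : ideal D -> dense (sumi A B) ->
  (forall r, A r -> dense (fun t => D (t * r))) ->
  (forall r, B r -> dense (fun t => D (t * r))) -> dense D.
Proof.
move=> iD dAB AD BD; have [_ DD _] := iD; apply: (dense_trans dAB) => _ [u [v [Au Bv ->]]].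
apply: dense_sub (dense_and _ _ (AD u Au) (BD v Bv)) => [t [h1 h2]||].
- by rewrite mulrDr; apply: DD.
- exact: ideal_mulr.
- exact: ideal_mulr.
Qed.

Lemma dense_mul_closed A r : ideal A -> A r -> dense (fun t => A (t * r)).
Proof. by move=> [_ _ AM] Ar; apply: dense1; rewrite mul1r. Qed.

(** * Submodules of K and generators *)

Lemma submod_colonl I y : submod I -> submod (fun x => I (y * x)).
Proof.
move=> [I0 ID IM]; split=> [|x z|r x]; rewrite ?mulr0 // ?mulrDr; first exact: ID.
by rewrite mulrCA; apply: IM.
Qed.

Lemma int_ideal_colon I y : submod I -> int_ideal (fun x => inR x /\ I (y * x)).
Proof.
move=> sI; split=> [|x []//]; have [h0 hD hM] := submod_colonl y sI.
have [k0 kD kM] := submod_inR.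
split=> [//|x z [kx hx] [kz hz]|r x [kx hx]]; first by split; [apply: kD|apply: hD].
by split; [apply: kM|apply: hM].
Qed.

Lemma genE (s : seq K) x : gen s x ->
  forall I, submod I -> (forall f, f \in s -> I f) -> I x.
Proof.
move=> [c [sc ->]] I [I0 ID IM] sI; elim/big_ind: _ => // i _.
by apply: IM; apply: sI; apply: mem_nth.
Qed.

Lemma submod_gen (s : seq K) : submod (gen s).
Proof.
split.
- exists (nseq (size s) 0); rewrite size_nseq; split=> //.
  rewrite big1 // => i _; by rewrite nth_nseq ltn_ord tofrac0 mul0r.
- move=> _ _ [c [sc ->]] [d [sd ->]].
  exists (mkseq (fun i => nth 0 c i + nth 0 d i) (size s)); rewrite size_mkseq; split=> //.
  rewrite -big_split; apply: eq_bigr => i _ /=.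
  by rewrite nth_mkseq // tofracD mulrDl.
- move=> r _ [c [sc ->]].
  exists (mkseq (fun i => r * nth 0 c i) (size s)); rewrite size_mkseq; split=> //.
  rewrite mulr_sumr; apply: eq_bigr => i _ /=.
  by rewrite nth_mkseq // tofracM mulrA.
Qed.

Lemma mem_gen (s : seq K) f : f \in s -> gen s f.
Proof.
move=> fs; exists (mkseq (fun i => (i == index f s)%:R) (size s)).
rewrite size_mkseq; split=> //.
have li : (index f s < size s)%N by rewrite index_mem.
rewrite (bigD1 (Ordinal li)) //= nth_mkseq // eqxx tofrac1 mul1r nth_index //.
rewrite big1 ?addr0 // => i; rewrite -val_eqE /= => /negbTE ni.
by rewrite nth_mkseq // ni tofrac0 mul0r.
Qed.

Lemma gen_seqR (s : seq K) : (forall f, f \in s -> inR f) ->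
  exists s' : seq R, s = [seq f%:F | f <- s'].
Proof.
elim: s => [|f s IHs] sR; first by exists [::].
have [|s' ->] := IHs; first by move=> g gs; apply: sR; rewrite inE gs orbT.
have [r ->] := sR f (mem_head _ _).
by exists (r :: s').
Qed.

Lemma fg_idealP J : fg_ideal J ->
  exists s : seq R, seteq J (gen [seq f%:F | f <- s]).
Proof.
move=> [JR [s Js]].
have [|s' Es] := @gen_seqR s; first by move=> f fs; apply/JR/Js/mem_gen.
by exists s'; rewrite -Es.
Qed.

Lemma fg_ideal_gen (s : seq R) : fg_ideal (gen [seq f%:F | f <- s]).
Proof.
split; last by exists [seq f%:F | f <- s].
move=> x /genE; apply; first exact: submod_inR.
by move=> _ /mapP[f _ ->].
Qed.

Lemma colon_gen (s : seq R) J I x : seteq J (gen [seq f%:F | f <- s]) -> submod I ->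
  colon I J x <-> forall f, f \in s -> I (x * f%:F).
Proof.
move=> Js sI; split=> [h f fs|h y /Js/genE].
  by apply/h/Js/mem_gen/map_f.
move=> /(_ _ (submod_colonl x sI)); apply.
by move=> _ /mapP[f fs ->]; apply: h.
Qed.

(** * The v- and w-operations in terms of density *)

Lemma vop_gv (s : seq R) J : seteq J (gen [seq f%:F | f <- s]) ->
  vop J 1 <-> gv s.
Proof.
move=> Js; have cE z := colon_gen z Js submod_inR.
split=> [v1 z hz|gs z /cE/gs]; last by rewrite mul1r.
by rewrite -[z]mul1r; apply/v1/cE.
Qed.

Lemma vop_subR J x : subs J (@inR R) -> vop J x -> inR x.
Proof. by move=> JR vx; rewrite -[x]mulr1; apply: vx => b /JR; rewrite mul1r. Qed.

Lemma submod_vop I : submod (vop I).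
Proof.
split=> [b _|x y hx hy b hb|r x hx b hb].
- by rewrite mul0r; apply: (submod0 submod_inR).
- by rewrite mulrDl; apply: inR_D; [apply: hx|apply: hy].
- by rewrite -mulrA; apply: inR_M => //; apply: hx.
Qed.

Lemma submod1 I : submod I -> I 1 -> forall x, inR x -> I x.
Proof. by move=> [_ _ IM] I1 _ [r ->]; rewrite -[_%:F]mulr1; apply: IM. Qed.

Lemma vop_seteqR J : subs J (@inR R) -> seteq (vop J) (@inR R) <-> vop J 1.
Proof.
move=> JR; split=> [h|v1 x]; first by apply/h; rewrite -tofrac1.
split; first exact: vop_subR.
exact: submod1 (submod_vop J) v1 x.
Qed.

(** Turns questions about w into density of ideals of R: a finitely generated J with J_v = R and xJ
    inside I is generated by a [gv] sequence contained in (I : x), and conversely. *)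
Lemma wopP I x : submod I -> wop I x <-> dense (colonr I x).
Proof.
move=> sI; split=> [[J [fgJ vJ cJ]]|[s [sI' gs]]].
  have [s Js] := fg_idealP fgJ; exists s; split.
    by move=> f fs; rewrite /colonr mulrC; apply: (colon_gen x Js sI).1.
  by apply/(vop_gv Js)/vJ; rewrite -tofrac1.
exists (gen [seq f%:F | f <- s]); split; first exact: fg_ideal_gen.
  by apply/vop_seteqR; [apply: (fg_ideal_gen s).1 | apply/(@vop_gv s)].
by apply/(@colon_gen s) => // f fs; rewrite mulrC; apply: sI'.
Qed.

Lemma sub_wop I : submod I -> subs I (wop I).
Proof. by move=> sI x Ix; apply/wopP => //; apply: dense1; rewrite /colonr tofrac1 mul1r. Qed.

Lemma wop_mono I J : submod I -> submod J -> subs I J -> subs (wop I) (wop J).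
Proof. by move=> sI sJ IJ x /(wopP _ sI) h; apply/wopP => //; apply: dense_sub h => r /IJ. Qed.

Lemma wop_idem I J : submod I -> submod J -> subs I (wop J) -> subs (wop I) (wop J).
Proof.
move=> sI sJ IJ x /(wopP _ sI) h; apply/wopP => //; apply: (dense_trans h) => r.
move=> /IJ /(wopP _ sJ); apply: dense_sub => t; by rewrite /colonr tofracM mulrA.
Qed.

Lemma submod_wop I : submod I -> submod (wop I).
Proof.
move=> sI; have [I0 ID IM] := sI; split=> [|x y|r x].
- exact: sub_wop.
- move=> /(wopP _ sI) hx /(wopP _ sI) hy; apply/wopP => //.
  apply: dense_sub (dense_and _ _ hx hy); try exact: ideal_colonr.
  by move=> r [Ix Iy]; rewrite /colonr mulrDr; apply: ID.
- move=> /(wopP _ sI) h; apply/wopP => //; apply: dense_sub h => t.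
  by rewrite /colonr mulrCA; apply: IM.
Qed.

(** * Products, powers and w-reductions *)

Lemma prodI_ind I J (P : K -> Prop) : P 0 -> (forall x y, P x -> P y -> P (x + y)) ->
  (forall x y, I x -> J y -> P (x * y)) -> subs (prodI I J) P.
Proof.
move=> P0 PD PM x [s [sIJ ->]]; rewrite big_seq; elim/big_ind: _ => // p /sIJ[].
exact: PM.
Qed.

Lemma prodI_mul I J x y : I x -> J y -> prodI I J (x * y).
Proof.
move=> Ix Jy; exists [:: (x, y)]; rewrite big_seq1; split=> // p.
by rewrite inE => /eqP ->.
Qed.

Lemma submod_prodI I J : submod I -> submod (prodI I J).
Proof.
move=> [_ _ IM]; split.
- by exists [::]; rewrite big_nil.
- move=> _ _ [s [hs ->]] [s' [hs' ->]]; exists (s ++ s'); rewrite big_cat; split=> // p.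
  by rewrite mem_cat => /orP[/hs|/hs'].
- move=> r _ [s [hs ->]]; exists [seq (r%:F * p.1, p.2) | p <- s]; split.
    by move=> _ /mapP[p /hs[h1 h2] ->]; split=> //; apply: IM.
  by rewrite big_map mulr_sumr; apply: eq_bigr => p _; rewrite mulrA.
Qed.

Lemma submod_powI I n : submod (powI I n).
Proof. by elim: n => [|n IHn] /=; [apply: submod_inR | apply: submod_prodI]. Qed.

Lemma powI_subR I n : int_ideal I -> subs (powI I n) (@inR R).
Proof.
move=> [sI IR]; elim: n => [|n IHn] //=; apply: prodI_ind; first exact: (submod0 submod_inR).
  exact: inR_D.
by move=> x y /IHn hx /IR hy; apply: inR_M.
Qed.

Lemma powI1 I x : submod I -> I x -> powI I 1 x.
Proof. by move=> sI Ix; rewrite -[x]mul1r; apply: prodI_mul => //; rewrite -tofrac1. Qed.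

Lemma powI1_sub I : submod I -> subs (powI I 1) I.
Proof.
move=> [I0 ID IM]; apply: prodI_ind => // _ y [r ->]; exact: IM.
Qed.

(* [n = 1] in the definition of a w-reduction *)
Lemma w_reductionI I J : int_ideal I -> int_ideal J -> subs J I ->
  (forall x y, I x -> I y -> wop (prodI J I) (x * y)) -> w_reduction J I.
Proof.
move=> iI iJ JI h; have [sI _] := iI; have [sJ _] := iJ; split=> //; exists 1%N.
have sP : submod (prodI J (powI I 1)) by apply: submod_prodI.
have sQ : submod (powI I 2) by apply: submod_powI.
have sPJ : submod (prodI J I) by apply: submod_prodI.
move=> x; split; last first.
  apply: wop_idem => //; apply: (@prodI_ind (powI I 1) I).
    exact: submod0 (submod_wop sP).
    by move=> u v; apply: submodD (submod_wop sP).
  move=> u v /(powI1_sub sI) Iu Iv; have := h _ _ Iu Iv.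
  apply: wop_mono => //; apply: prodI_ind; first by case: sP.
    by case: sP.
  by move=> a b Ja Ib; apply: prodI_mul => //; apply: powI1.
apply: wop_mono => //; apply: prodI_ind; first by case: sQ.
  by case: sQ.
move=> a b Ja /(powI1_sub sI) Ib; apply: prodI_mul => //; apply: powI1 => //; exact: JI.
Qed.

(** * Comparability of elements and the PvMD property *)

(** Global form of R_M being a valuation domain at each maximal t-ideal M: a dense ideal is not
    contained in M, so one of D(a,b), D(b,a) has an element outside M, and one of a, b divides the
    other in R_M. *)
Definition compar := forall a b, dense (sumi (quo a b) (quo b a)).

Lemma ideal_sumi A B : ideal A -> ideal B -> ideal (sumi A B).
Proof.
move=> [A0 AD AM] [B0 BD BM]; split.
- by exists 0, 0; rewrite addr0.
- move=> _ _ [u [v [Au Bv ->]]] [u' [v' [Au' Bv' ->]]].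
  by exists (u + u'), (v + v'); split; [exact: AD|exact: BD|rewrite addrACA].
- move=> r _ [u [v [Au Bv ->]]].
  by exists (r * u), (r * v); split; [exact: AM|exact: BM|rewrite mulrDr].
Qed.

(** This ideal is the w-closure of A intersected with R; [compar_dense] applies its induction
    hypothesis to it. *)
Lemma ideal_dense A : ideal A -> ideal (fun t => dense (fun r => A (r * t))).
Proof.
move=> iA; have [A0 AD AM] := iA.
split.
- by apply: dense1; rewrite mulr0.
- move=> r t hr ht; apply: dense_sub (dense_and _ _ hr ht) => [x [hx hy]||]; try exact: ideal_mulr.
  by rewrite mulrDr; apply: AD.
- by move=> r t; apply: dense_sub => x Ax; rewrite mulrCA; apply: AM.
Qed.

Definition img A : fset R := fun x => exists2 r, x = r%:F & A r.

Lemma imgE A r : img A r%:F <-> A r.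
Proof. by split=> [[s /FI ->]|] //; exists r. Qed.

Lemma submod_image A : ideal A -> submod (img A).
Proof.
move=> [A0 AD AM]; split.
- by exists 0; rewrite ?tofrac0.
- by move=> _ _ [r -> Ar] [t -> At]; exists (r + t); rewrite ?tofracD //; apply: AD.
- by move=> r _ [t -> At]; exists (r * t); rewrite ?tofracM //; apply: AM.
Qed.

Lemma int_ideal_img A : ideal A -> int_ideal (img A).
Proof. by move=> iA; split; [apply: submod_image|move=> _ [r -> _]]. Qed.

(** Take I = (a, b). For y in the inverse of I put p = ya and q = yb; then pb = aq, so p lies in
    D(a,b) and q in D(b,a). Hence the product of I with its inverse lies in D(a,b) + D(b,a). *)
Lemma PvMD_compar : PvMD R -> compar.
Proof.
move=> hP a b.
have iS : ideal (sumi (quo a b) (quo b a)) by apply: ideal_sumi; apply: ideal_quo.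
have [_ _ iSM] := iS.
have [a0|a0] := eqVneq a 0.
  (* For a = 0 the unit 1 lies in D(b,0). *)
  apply: dense1; exists 0, 1; rewrite add0r; split=> //; exists 0; rewrite ?a0; ring.
have fgI := fg_ideal_gen [:: a; b]; set I := gen _ in fgI.
have Ia : I a%:F by apply: mem_gen; rewrite inE eqxx.
have Ib : I b%:F by apply: mem_gen; rewrite !inE eqxx orbT.
have [||J [fgJ _ JI vJ]] := (hP I fgI _ 1).2; first by exists a%:F; rewrite tofrac_eq0.
  by rewrite -tofrac1.
have [s Js] := fg_idealP fgJ.
exists s; split; last exact/(vop_gv Js).
move=> f fs; have : prodI I (inv I) f%:F by apply/JI/Js/mem_gen/map_f.
have sS := submod_image iS.
suff h : subs (prodI I (inv I)) (img (sumi (quo a b) (quo b a))).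
  by move=> /h/imgE.
apply: prodI_ind; first exact: submod0 sS.
  by move=> x y; apply: submodD sS.
move=> x y /genE Ix yI.
have [p Ep] := yI _ Ia; have [q Eq] := yI _ Ib.
rewrite mulrC; apply: (Ix _ (submod_colonl y sS)) => _ /mapP[c cs ->].
have pq : p * b = a * q by apply: FI; rewrite !tofracM -Ep -Eq; ring.
have [iD1 _ _] := ideal_quo a b; have [iD2 _ _] := ideal_quo b a.
move: cs; rewrite !inE => /orP[] /eqP ->.
  by exists p => //; exists p, 0; rewrite addr0; split=> //; exists q.
by exists q => //; exists 0, q; rewrite add0r; split=> //; exists p; rewrite mulrC -pq mulrC.
Qed.

(** Globalizes the fact that in a valuation domain some member of a finite nonempty set divides all
    the others. Comparing the divisor c of the tail with the new element b yields only a dense set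
    of multipliers, so the induction runs on the w-closure of D. *)
Lemma compar_dense (s : seq R) D : compar -> ideal D -> s != [::] ->
  (forall c e, c \in s -> (forall f, f \in s -> quo c f e) -> D e) -> dense D.
Proof.
move=> hC; elim: s D => [//|b s IHs] D iD _ hD.
have [s0|s0] := eqVneq s [::].
  apply: dense1; apply: (hD b) => [|f]; first exact: mem_head.
  by rewrite s0 inE => /eqP ->; exists 1; rewrite mulrC.
apply: (dense_trans (IHs _ (ideal_dense iD) s0 _)) => // c e cs he.
apply: (dense_sumi (ideal_mulr e iD) (hC c b)) => u hu; apply: dense1; rewrite mul1r.
  apply: (hD c) => [|f]; first by rewrite inE cs orbT.
  rewrite inE => /orP[/eqP ->|fs].
    by case: hu => w hw; exists (w * e); rewrite mulrAC hw mulrA.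
  by case: (he f fs) => w hw; exists (u * w); rewrite -mulrA hw mulrCA.
case: hu => w hw; apply: (hD b) => [|f]; first exact: mem_head.
rewrite inE => /orP[/eqP ->|fs].
  by exists (u * e); rewrite mulrC.
by case: (he f fs) => w' hw'; exists (w * w'); rewrite -mulrA hw' mulrA hw mulrA.
Qed.

Lemma top_dense I : int_ideal I -> nonzero I -> dense (trace I) -> top I 1.
Proof.
move=> [sI IR] [x0 [Ix0 nx0]] [s [sI' gs]]; have [r0 Er] := IR _ Ix0.
(* The nonzero [r0] is added because [top] asks for a nonzero J, while over a field even the empty
   sequence is [gv]. *)
exists (gen [seq f%:F | f <- r0 :: s]); split.
- exact: fg_ideal_gen.
- by exists x0; split=> //; apply: mem_gen; rewrite Er inE eqxx.
- move=> x /genE; apply=> // _ /mapP[f + ->].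
  by rewrite inE => /orP[/eqP ->|/sI' //]; rewrite -Er.
- apply/(@vop_gv (r0 :: s)) => // z hz; apply: gs => f fs; apply: hz.
  by rewrite inE fs orbT.
Qed.

Lemma top_subR I x : subs I (@inR R) -> top I x -> inR x.
Proof. by move=> IR [J [_ _ JI]]; apply: vop_subR => y /JI/IR. Qed.

(** If c is a nonzero generator of I and e lies in D(c,f) for every generator f, then e/c is in the
    inverse of I, so e = c(e/c) is in the product. [compar_dense] then makes the product dense. *)
Lemma compar_PvMD : compar -> PvMD R.
Proof.
move=> hC I fgI [x0 [Ix0 nx0]]; have [s Is] := fg_idealP fgI.
have sI : submod I.
  have [h0 hD hM] := submod_gen [seq f%:F | f <- s].
  by split=> [|x y /Is ? /Is ?|r x /Is ?]; apply/Is => //; [apply: hD | apply: hM].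
have PR : subs (prodI I (inv I)) (@inR R).
  apply: prodI_ind; [exact: submod0 submod_inR|exact: inR_D|].
  by move=> x y Ix hy; rewrite mulrC; apply: hy.
have sP : submod (prodI I (inv I)) by apply: submod_prodI.
have nzs : exists2 f, f \in s & f != 0.
  apply: contrapT => h; case/eqP: nx0; have /genE := (Is x0).1 Ix0.
  have s0 : submod (fun x : K => x = 0).
    by split=> [|x y -> ->|r x ->]; rewrite ?addr0 ?mulr0.
  move=> /(_ _ s0) -> // _ /mapP[f fs ->]; apply/eqP; rewrite tofrac_eq0.
  apply/negPn/negP => nf.
  by apply: h; exists f.
have [f0 f0s nf0] := nzs.
have dP : dense (trace (prodI I (inv I))).
  apply: (compar_dense (s := s)) => //; first exact: ideal_trace.
    by apply: contraTneq f0s => ->.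
  move=> c e cs he; have [c0|c0] := eqVneq c 0.
    have [w] := he _ f0s; rewrite c0 mul0r => /eqP; rewrite mulf_eq0 (negbTE nf0) orbF.
    by move=> /eqP ->; rewrite /trace tofrac0; apply: submod0.
  have cF : c%:F != 0 by rewrite tofrac_eq0.
  rewrite /trace -[e%:F](divfK cF) mulrC; apply: prodI_mul; first exact/Is/mem_gen/map_f.
  apply/(colon_gen _ Is submod_inR) => f fs; have [w hw] := he f fs.
  by exists w; rewrite mulrAC -tofracM hw tofracM mulrAC divff // mul1r.
have nP : nonzero (prodI I (inv I)).
  exists x0; split=> //; rewrite -[x0]mulr1; apply: prodI_mul => // y /fgI.1.
  by rewrite mul1r.
have [J [fgJ nJ JP vJ]] := top_dense (conj sP PR) nP dP.
move=> x; split=> [/top_subR|xR]; first exact.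
by exists J; split=> //; apply: submod1 (submod_vop J) vJ _ xR.
Qed.

(** * Maximal t-ideals as maximal nondense ideals *)

Lemma t_ideal_nondense M : int_ideal M -> proper M -> t_ideal M -> ~ dense (trace M).
Proof.
move=> iM pM tM dM; have [sM MR] := iM; apply: pM => x; split; first exact: MR.
apply: submod1 => //; apply/tM/top_dense => //.
(* Since [top] ranges over nonzero J, the membership of 0 in [top M] already provides a nonzero
   element of M. *)
have [J [_ [y [Jy ny]] JM _]] := (tM 0).2 (submod0 sM).
by exists y; split=> //; apply: JM.
Qed.

Lemma sub_top I : int_ideal I -> nonzero I -> subs I (top I).
Proof.
move=> [sI IR] [x0 [Ix0 nx0]] x Ix; have [r0 Er0] := IR _ Ix0; have [r Er] := IR _ Ix.
have gx f : f \in [:: r; r0] -> gen [seq f%:F | f <- [:: r; r0]] f%:F.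
  by move=> h; apply/mem_gen/map_f.
exists (gen [seq f%:F | f <- [:: r; r0]]); split.
- exact: fg_ideal_gen.
- by exists x0; split=> //; rewrite Er0; apply: gx; rewrite !inE eqxx orbT.
- move=> y /genE; apply=> // _ /mapP[f + ->].
  by rewrite !inE => /orP[] /eqP ->; rewrite -?Er -?Er0.
- by move=> z hz; rewrite mulrC; apply: hz; rewrite Er; apply: gx; rewrite inE eqxx.
Qed.

Lemma t_ideal_nonzero M : submod M -> t_ideal M -> nonzero M.
Proof.
move=> sM tM; have [J [_ [y [Jy ny]] JM _]] := (tM 0).2 (submod0 sM).
by exists y; split=> //; apply: JM.
Qed.

(** For b outside M the ideal N = (M : b) is again a proper t-ideal: if J is inside N then bJ is
    inside M, and x in J_v gives bx in (bJ)_v. By maximality N = M, so ab in M forces a in M. *)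
Lemma maximal_t_prime M : maximal_t_ideal M -> prime_ideal M.
Proof.
move=> [iM pM tM maxM]; split=> // a b Mab; have [sM MR] := iM.
apply: contrapT => /not_orP[na nb].
have [y0 [My0 ny0]] := t_ideal_nonzero sM tM.
have b0 : b%:F != 0 by apply: contra_notN nb => /eqP ->; apply: submod0.
pose N x := inR x /\ M (b%:F * x).
have iN : int_ideal N := int_ideal_colon b%:F sM.
have MN : subs M N by move=> x Mx; split; [apply: MR | apply: submodM].
have nN : nonzero N by exists y0; split=> //; apply: MN.
suff tN : t_ideal N.
  apply: na; apply/(maxM N iN _ tN MN); last by split=> //; rewrite -tofracM mulrC.
  move=> NR; apply: nb; have [] := (NR 1).2; first by rewrite -tofrac1.
  by rewrite mulr1.
move=> x; split; last exact: sub_top.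
move=> tx; have xR : inR x by apply: top_subR tx => y [].
split=> //; apply/tM; have [J [fgJ [y [Jy ny]] JN vx]] := tx.
have [s Js] := fg_idealP fgJ; have fgJ' := fg_ideal_gen [seq b * f | f <- s].
have JJ' z : J z -> gen [seq f%:F | f <- [seq b * f | f <- s]] (b%:F * z).
  move=> /Js/genE /(_ _ (submod_colonl b%:F (submod_gen _))); apply => _ /mapP[f fs ->].
  by rewrite -tofracM; apply/mem_gen/map_f/map_f.
eexists; split; first exact: fgJ'.
- by exists (b%:F * y); split; [apply: JJ' | rewrite mulf_neq0].
- move=> z /genE; apply=> // _ /mapP[_ /mapP[f fs ->] ->].
  by rewrite tofracM; apply: (JN _ _).2; apply/Js/mem_gen/map_f.
- move=> z hz; have -> : b%:F * x * z = x * (z * b%:F) by ring.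
  by apply: vx => u Ju; rewrite -mulrA; apply: hz; apply: JJ'.
Qed.

(** Density is witnessed by finitely many elements, so nondense ideals are closed under unions of
    chains. *)
Lemma maximal_nondense (A0 : fset R) : int_ideal A0 -> ~ dense (trace A0) ->
  exists M, [/\ int_ideal M, ~ dense (trace M), subs A0 M &
    forall Q, int_ideal Q -> ~ dense (trace Q) -> subs M Q -> subs Q M].
Proof.
move=> iA nA; have [sA AR] := iA.
(* The union with [A0] is built in so that the empty chain, whose union is empty, also satisfies
   P. *)
pose P (X : set K) := int_ideal (X `|` A0)%classic /\ ~ dense (trace (X `|` A0)%classic).
have [|X [[iX nX] maxX]] := @Zorn_bigcup K P.
  move=> F FP totF.
  have two : forall x y, (\bigcup_(X in F) X `|` A0)%classic x ->
      (\bigcup_(X in F) X `|` A0)%classic y ->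
      exists Y : set K, [/\ int_ideal (Y `|` A0)%classic, (Y `<=` \bigcup_(X in F) X)%classic,
        (Y `|` A0)%classic x & (Y `|` A0)%classic y].
    have P0 : int_ideal (set0 `|` A0)%classic by rewrite set0U.
    move=> x y [[X FX Xx]|Ax] [[Y FY Yy]|Ay].
    - have [XY|YX] := totF _ _ FX FY.
        by exists Y; split; [exact: (FP _ FY).1|move=> z; exists Y|left; apply: XY|left].
      by exists X; split; [exact: (FP _ FX).1|move=> z; exists X|left|left; apply: YX].
    - by exists X; split; [exact: (FP _ FX).1|move=> z; exists X|left|right].
    - by exists Y; split; [exact: (FP _ FY).1|move=> z; exists Y|right|left].
    - by exists set0; split=> //; right.
  split; first split; first split.
  - by right; apply: submod0.
  - move=> x y hx hy; have [Y [[[_ YD _] _] YF Yx Yy]] := two _ _ hx hy.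
    by have [/YF|] := YD _ _ Yx Yy; [left|right].
  - move=> r x hx; have [Y [[[_ _ YM] _] YF Yx _]] := two _ _ hx hx.
    by have [/YF|] := YM r _ Yx; [left|right].
  - by move=> x [[X FX Xx]|/AR //]; apply: (FP _ FX).1.2; left.
  - move=> [s [hs gs]]; apply: nA.
    (* One member of the chain captures the whole sequence; [set0] stands in when every element
       comes from [A0]. *)
    suff [Y [PY YA]] : exists Y : set K, (int_ideal (Y `|` A0)%classic /\
         (Y = set0 \/ F Y)) /\ forall f, f \in s -> (Y `|` A0)%classic f%:F.
      case: PY => iY [Y0|/FP[_ nY]]; last by case: nY; exists s.
      by exists s; split=> // f /YA; rewrite Y0 set0U.
    elim: s hs {gs} => [|f s IHs] hs.
      by exists set0; split=> //; split; [rewrite set0U|left].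
    have [|Y [[iY FY] YA]] := IHs; first by move=> g gs; apply: hs; rewrite inE gs orbT.
    have [[X FX Xf]|Af] := hs f (mem_head _ _); last first.
      by exists Y; split=> // g; rewrite inE => /orP[/eqP ->|/YA //]; right.
    have key (Z : set K) : Z f%:F -> (Y `<=` Z)%classic ->
        forall g, g \in f :: s -> (Z `|` A0)%classic g%:F.
      by move=> Zf YZ g; rewrite inE => /orP[/eqP ->|/YA[/YZ|]]; [left|left|right].
    case: FY => [Y0|FY].
      by exists X; split; [split; [exact: (FP _ FX).1|right]|apply: key => //; rewrite Y0].
    have [XY|YX] := totF _ _ FX FY.
      by exists Y; split; [split; [|right]|apply: key => //; apply: XY].
    by exists X; split; [split; [exact: (FP _ FX).1|right]|apply: key].
exists (X `|` A0)%classic; split=> // [x|Q iQ nQ XQ x Qx]; first by right.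
apply: contrapT => nx; apply: (maxX Q); last first.
  have QA : (Q `|` A0)%classic = Q by apply/setUidPl => y Ay; apply: XQ; right.
  by split; rewrite QA.
split=> [y Xy|QX]; first by apply: XQ; left.
by apply: nx; left; apply: QX.
Qed.

(** If x were in M_t but not in M, then M + xR would be dense by maximality. As x lies in J_v for
    some finitely generated J inside M, adding generators of J lets x be dropped from the witnesses,
    and M itself would be dense. *)
Lemma nondense_maximal_t M : int_ideal M -> nonzero M -> ~ dense (trace M) ->
  (forall Q, int_ideal Q -> ~ dense (trace Q) -> subs M Q -> subs Q M) ->
  maximal_t_ideal M.
Proof.
move=> iM nM dM maxM; have [sM MR] := iM; split=> //.
- by move=> MRR; apply: dM; apply: dense1; apply/MRR.
- move=> x; split; last exact: sub_top.
  move=> tx; have [r Er] := top_subR MR tx; apply: contrapT => nMx.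
  pose Q y := exists m t, [/\ M m, y = m + t%:F * x & True].
  have [J [fgJ _ JM vx]] := tx; have [s Js] := fg_idealP fgJ.
  have sQ : submod Q.
    split.
    - by exists 0, 0; rewrite tofrac0 mul0r addr0; split=> //; apply: submod0.
    - move=> _ _ [m [t [Mm -> _]]] [m' [t' [Mm' -> _]]].
      exists (m + m'), (t + t'); split=> //; first exact: submodD.
      by rewrite tofracD mulrDl addrACA.
    - move=> u _ [m [t [Mm -> _]]]; exists (u%:F * m), (u * t); split=> //.
        exact: submodM.
      by rewrite tofracM mulrDr mulrA.
  have iQ : int_ideal Q.
    split=> // _ [m [t [Mm -> _]]]; apply: inR_D; first exact: MR.
    by rewrite Er; apply: inR_M.
  have MQ : subs M Q by move=> m Mm; exists m, 0; rewrite tofrac0 mul0r addr0.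
  have Qx : Q x by exists 0, 1; rewrite tofrac1 mul1r add0r; split=> //; apply: submod0.
  apply: nMx; apply: (maxM Q) => // -[s' [hs' gs']]; apply: dM.
  (* Each witness has the form m + tx. Keeping only the m suffices, because a z that sends J into R
     also sends x into R. *)
  suff [s2 [s2M hs2]] : exists s2 : seq R, (forall f, f \in s2 -> M f%:F) /\
      forall z, inR (z * x) -> (forall f, f \in s2 -> inR (z * f%:F)) ->
        forall f, f \in s' -> inR (z * f%:F).
    exists (s ++ s2); split.
      move=> f; rewrite mem_cat => /orP[fs|/s2M //].
      by apply/JM/Js/mem_gen/map_f.
    move=> z hz; apply: gs' => f; apply: hs2 f => [|f fs2]; last first.
      by apply: hz; rewrite mem_cat fs2 orbT.
    rewrite mulrC; apply: vx; apply/(colon_gen _ Js submod_inR) => f fs.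
    by apply: hz; rewrite mem_cat fs.
  elim: s' hs' {gs'} => [|f s' IHs] hs; first by exists [::].
  have [|s2 [s2M hs2]] := IHs; first by move=> g gs; apply: hs; rewrite inE gs orbT.
  have [m [t [Mm Ef _]]] := hs f (mem_head _ _); have [m' Em] := MR _ Mm.
  exists (m' :: s2); split.
    by move=> g; rewrite inE => /orP[/eqP ->|/s2M //]; rewrite -Em.
  move=> z zx hz g; rewrite inE => /orP[/eqP ->|gs].
    rewrite Ef mulrDr Em; apply: inR_D; first by apply: hz; apply: mem_head.
    by rewrite mulrCA; apply: inR_M.
  by apply: hs2 gs => // h hh; apply: hz; rewrite inE hh orbT.
- move=> Q iQ pQ tQ MQ x; split; first exact: MQ.
  by apply: (maxM Q iQ _ MQ); apply: t_ideal_nondense.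
Qed.

(** * Divisibility in R_M *)

Lemma dense_out A M : dense A -> ~ dense (trace M) -> exists r, A r /\ ~ M r%:F.
Proof.
move=> dA nM; apply: contrapT => h; apply: nM; apply: dense_sub dA => r Ar.
by apply: contrapT => nMr; apply: h; exists r.
Qed.

Lemma prime_mul M r t : prime_ideal M -> ~ M r%:F -> ~ M t%:F -> ~ M (r * t)%:F.
Proof. by move=> [_ _ pM] nr nt /pM[]. Qed.

Lemma prime_1 M : prime_ideal M -> ~ M 1%:F.
Proof.
move=> [[sM MR] pM _] M1; apply: pM => x; split; first exact: MR.
by apply: submod1; rewrite -?tofrac1.
Qed.

Lemma compar_out M a b : compar -> submod M -> ~ dense (trace M) ->
  exists t, ~ M t%:F /\ (quo a b t \/ quo b a t).
Proof.
move=> hC sM nM; have [_ [[u [v [hu hv ->]]] nuv]] := dense_out (hC a b) nM.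
have [Mu|Mu] := EM (M u%:F); last by exists u; split=> //; left.
have [Mv|Mv] := EM (M v%:F); last by exists v; split=> //; right.
by case: nuv; rewrite tofracD; apply: submodD.
Qed.

(* [loc M q] is the contraction to [R] of [q R_M]. *)
Definition loc M q : R -> Prop := fun r => exists t u, ~ M t%:F /\ t * r = q * u.

Lemma ideal_loc M q : prime_ideal M -> ideal (loc M q).
Proof.
move=> prM; split.
- by exists 1, 0; split; [exact: prime_1|ring].
- move=> r s [t [u [nt E]]] [t' [u' [nt' E']]].
  exists (t * t'), (t' * u + t * u'); split; first exact: prime_mul.
  have -> : t * t' * (r + s) = t' * (t * r) + t * (t' * s) by ring.
  by rewrite E E'; ring.
- move=> r s [t [u [nt E]]].
  by exists t, (r * u); split=> //; rewrite mulrCA E mulrCA.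
Qed.

(* Otherwise [a = x y] in [R_M] with [y] in [M], and the elements of [R] divisible in [R_M] by
   every power of [y] form a prime ideal, nonzero because of [c] and missing [y]. *)
Lemma rank_one M (a x c : R) : compar -> height_one M -> ~ dense (trace M) ->
  a != 0 -> c != 0 ->
  (forall k, loc M (a ^+ k) (x ^+ k * c)) -> loc M a x.
Proof.
move=> hC [prM nM h1] dM a0 c0 hk; have [[sM MR] _ pM] := prM.
apply: contrapT => nax.
have [v [nv [hv|[y vy]]]] := compar_out a x hC sM dM.
  by case: nax; case: hv => y E; exists v, y.
have My : M y%:F.
  by apply: contrapT => ny; apply: nax; exists y, v; split=> //; rewrite mulrC -vy mulrC.
have v0 : v != 0 by apply: contra_notN nv => /eqP ->; rewrite tofrac0; apply: submod0.
have y0 : y != 0.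
  apply: contraTneq (mulf_neq0 v0 a0) => E; by rewrite vy E mulr0 eqxx.
pose P' (z : R) := forall k, loc M (y ^+ k) z.
have iP : ideal P'.
  split=> [k|u w hu hw k|u w hw k]; have [h0 hD hM] := ideal_loc (y ^+ k) prM.
  - exact: h0.
  - exact: hD.
  - exact: hM.
pose P := img P'; have PE r : P r%:F <-> P' r := imgE _ _.
have PM : subs P M.
  move=> _ [r -> /(_ 1%N)[t [u [nt E]]]].
  have [] // : M t%:F \/ M r%:F; apply: pM; rewrite E expr1 mulrC tofracM.
  exact: submodM.
have nPy : ~ P' y.
  move=> /(_ 2%N)[t [r [nt E]]]; apply: nt.
  have -> : t = y * r by apply: (mulIf y0); rewrite E; ring.
  by rewrite mulrC tofracM; apply: submodM.
have prP : prime_ideal P.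
  split; first exact: int_ideal_img.
    by move=> PR; apply: nPy; apply/PE/PR.
  move=> z z' /PE Pzz; apply: contrapT => /not_orP[/PE nz /PE nz'].
  (* By comparability an element outside P' divides a power of y in R_M. Two such elements z, z'
     then have zz' dividing y^(k+l); if y^(k+l+1) divided zz', y would be a unit. *)
  have gap (w : R) : ~ P' w -> exists k t r, ~ M t%:F /\ t * y ^+ k = w * r.
    move=> /existsNP[k hw]; exists k.
    have [t [nt [[r E]|[r E]]]] := compar_out (y ^+ k) w hC sM dM.
      by case: hw; exists t, r.
    by exists t, r.
  have [k [t [r [nt E]]]] := gap _ nz; have [l [t' [r' [nt' E']]]] := gap _ nz'.
  have [t2 [r2 [nt2 E2]]] := Pzz (k + l).+1.
  case: (prime_mul prM nt2 (prime_mul prM nt nt')).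
  have -> : t2 * (t * t') = y * (r2 * r * r').
    apply: (mulIf (expf_neq0 (k + l) y0)).
    have -> : t2 * (t * t') * y ^+ (k + l) = t2 * ((t * y ^+ k) * (t' * y ^+ l)).
      by rewrite exprD; ring.
    rewrite E E'; have -> : t2 * (z * r * (z' * r')) = t2 * (z * z') * (r * r') by ring.
    by rewrite E2 exprS; ring.
  by rewrite mulrC tofracM; apply: submodM.
have nP : nonzero P.
  exists c%:F; rewrite tofrac_eq0; split=> //; apply/PE => k.
  (* Since va = xy, multiplying t x^k c = a^k r by y^k and cancelling a^k gives t v^k c = y^k r. *)
  have [t [r [nt E]]] := hk k; exists (t * v ^+ k), r; split.
    elim: k {E} => [|k IHk]; first by rewrite expr0 mulr1.
    by rewrite exprSr mulrA; apply: prime_mul.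
  apply: (mulIf (expf_neq0 k a0)).
  have -> : t * v ^+ k * c * a ^+ k = t * ((v * a) ^+ k * c) by rewrite exprMn; ring.
  by rewrite vy exprMn -[RHS]mulrA [r * _]mulrC -E; ring.
by apply: nPy; apply/PE/(h1 P prP nP PM).
Qed.

(** * PvMDs of t-dimension one have only w-basic ideals *)

Lemma powI_exp I a n : I a%:F -> powI I n (a ^+ n)%:F.
Proof.
by move=> Ia; elim: n => [|n IHn] //=; rewrite exprSr tofracM; apply: prodI_mul.
Qed.

Lemma w_basic_of_PvMD I : compar -> t_dim_one R -> int_ideal I -> w_basic I.
Proof.
move=> hC hT [sI IR] J [iJ JI [n redn]]; have [sJ JR] := iJ.
suff IJ : subs I (wop J).
  by move=> x; split; [apply: wop_mono | apply: wop_idem].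
have sJn : submod (prodI J (powI I n)) by apply: submod_prodI.
have sIn := submod_powI I n.
move=> x Ix; have [a Ea] := IR _ Ix; subst x; rename Ix into Ia.
have [a0|a0] := eqVneq a 0; first by rewrite a0 tofrac0; apply: submod0 (submod_wop sJ).
apply: contrapT => nJa.
pose A0 : fset R := fun z => inR z /\ J (a%:F * z).
have iA : int_ideal A0 := int_ideal_colon a%:F sJ.
have dA : ~ dense (trace A0).
  by move=> h; apply/nJa/wopP => //; apply: dense_sub h => r []; rewrite mulrC.
have red x c : I x -> powI I n c -> dense (colonr (prodI J (powI I n)) (x * c)).
  move=> Ix Ic; apply/wopP => //; apply/redn/sub_wop; first exact: (submod_powI I n.+1).
  by rewrite mulrC; apply: prodI_mul.
(* A0 contains J, so A0 = 0 would give J = 0. The conductor of a^(n+1) into J I^n would then be zero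
   and still dense, making A0 dense. *)
have nA : nonzero A0.
  apply: contrapT => h; apply: dA.
  have J0 y : J y -> y = 0.
    move=> Jy; apply/eqP/negPn/negP => ny; apply: h; exists y; split=> //.
    split; first exact: JR.
    exact: submodM.
  apply: dense_sub (red _ _ Ia (powI_exp n Ia)) => r h0; split=> //.
  suff : r%:F * (a%:F * (a ^+ n)%:F) = 0.
    rewrite -!tofracM => /eqP; rewrite tofrac_eq0 !mulf_eq0 expf_eq0 (negbTE a0) andbF !orbF.
    by move=> /eqP ->; rewrite mulr0 tofrac0; apply: submod0.
  suff /(_ _ h0) : subs (prodI J (powI I n)) (fun y => y = 0) by [].
  by apply: prodI_ind => [//|x y -> ->|x y /J0 -> _]; rewrite ?addr0 ?mul0r.
have [M [iM dM AM maxM]] := maximal_nondense iA dA.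
have nM : nonzero M by have [y [Ay ny]] := nA; exists y; split=> //; apply: AM.
have h1 := hT _ (nondense_maximal_t iM nM dM maxM).
have [prM _ _] := h1; have [[sM MR] _ pM] := prM.
(* If instead ta = jr with t outside M, then t lies in (J : a), which is inside M. *)
have Ja j : J j%:F -> loc M a j.
  move=> Jj; have [t [nt [[r E]|[r E]]]] := compar_out a j hC sM dM.
    by exists t, r.
  case: nt; apply: AM; split=> //; rewrite -tofracM mulrC E mulrC tofracM.
  exact: submodM.
(* Multiplication by x sends I^n R_M into a I^n R_M. *)
have step (x : R) c : I x%:F -> powI I n c ->
    exists t c', [/\ ~ M t%:F, powI I n c' & t%:F * (x%:F * c) = a%:F * c'].
  move=> Ix Ic; have [s [h ns]] := dense_out (red _ _ Ix Ic) dM.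
  suff /(_ _ h)[t [c' [nt Ic' E]]] : subs (prodI J (powI I n)) (fun y =>
      exists t c', [/\ ~ M t%:F, powI I n c' & t%:F * y = a%:F * c']).
    exists (t * s), c'; split=> //; first exact: prime_mul.
    by rewrite tofracM -mulrA.
  apply: prodI_ind.
  - by exists 1, 0; split; [exact: prime_1|exact: submod0|rewrite !mulr0].
  - move=> u v [t [c1 [nt I1 E]]] [t' [c2 [nt' I2 E']]].
    exists (t * t'), (t'%:F * c1 + t%:F * c2); split; first exact: prime_mul.
      by apply: submodD; [|apply: submodM|apply: submodM].
    have -> : (t * t')%:F * (u + v) = t'%:F * (t%:F * u) + t%:F * (t'%:F * v) by ring.
    by rewrite E E'; ring.
  - move=> j' d /[dup] Jj /JR[j Ej]; subst j' => Id; have [t [r [nt E]]] := Ja _ Jj.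
    exists t, (r%:F * d); split=> //; first exact: submodM.
    by rewrite mulrA -tofracM E tofracM mulrA.
(* Iterating [step] from a^n puts x^k a^n in a^k R_M for all k, so [rank_one] applies with c =
   a^n. *)
have div (x : R) : I x%:F -> loc M a x.
  move=> Ix; apply: (rank_one hC h1 dM a0 (expf_neq0 n a0)) => k.
  suff [t [c' [nt Ic' E]]] : exists t c', [/\ ~ M t%:F, powI I n c' &
      t%:F * ((x ^+ k)%:F * (a ^+ n)%:F) = (a ^+ k)%:F * c'].
    have [r Er] := powI_subR (conj sI IR) Ic'; exists t, r; split=> //.
    by apply: FI; rewrite !tofracM E Er.
  elim: k => [|k [t [c [nt Ic E]]]].
    exists 1, (a ^+ n)%:F; split; [exact: prime_1|exact: powI_exp|].
    by rewrite !expr0 tofrac1 !mul1r.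
  have [s [c' [ns Ic' E']]] := step _ _ Ix Ic; exists (s * t), c'; split=> //.
    exact: prime_mul.
  rewrite !exprS; have -> : (s * t)%:F * ((x * x ^+ k)%:F * (a ^+ n)%:F) =
     s%:F * x%:F * (t%:F * ((x ^+ k)%:F * (a ^+ n)%:F)) by ring.
  rewrite E.
  have -> : s%:F * x%:F * ((a ^+ k)%:F * c) = (a ^+ k)%:F * (s%:F * (x%:F * c)) by ring.
  by rewrite E'; ring.
have divn k c : powI I k c -> exists t r, ~ M t%:F /\ t%:F * c = (a ^+ k * r)%:F.
  elim: k c => [|k IHk] /=.
    by move=> _ [r ->]; exists 1, r; split; [exact: prime_1|rewrite expr0 tofrac1 !mul1r].
  apply: prodI_ind.
  - by exists 1, 0; split; [exact: prime_1|rewrite !mulr0 tofrac0].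
  - move=> u v [t [r [nt E]]] [t' [r' [nt' E']]].
    exists (t * t'), (t' * r + t * r'); split; first exact: prime_mul.
    have -> : (t * t')%:F * (u + v) = t'%:F * (t%:F * u) + t%:F * (t'%:F * v) by ring.
    by rewrite E E' -!tofracM -tofracD; congr _%:F; ring.
  - move=> u v' /IHk[t [r [nt E]]] /[dup] Iv /IR[v Ev]; subst v'.
    have [t' [r' [nt' E']]] := div _ Iv.
    exists (t * t'), (r * r'); split; first exact: prime_mul.
    have -> : (t * t')%:F * (u * v%:F) = (t%:F * u) * (t' * v)%:F by ring.
    by rewrite E E' -tofracM exprS; congr _%:F; ring.
(* Some s outside M has s a^(n+1) in J I^n, which lies in a^n J R_M by [divn]. Cancelling a^n gives
   tsa in J with ts outside M, against the inclusion of (J : a) in M. *)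
have [s [h ns]] := dense_out (red _ _ Ia (powI_exp n Ia)) dM.
suff /(_ _ h)[t [j [nt Jj E]]] : subs (prodI J (powI I n)) (fun y =>
    exists t j, [/\ ~ M t%:F, J j & t%:F * y = (a ^+ n)%:F * j]).
  apply: (prime_mul prM nt ns); apply: AM; split=> //.
  suff -> : a%:F * (t * s)%:F = j by [].
  have an : (a ^+ n)%:F != 0 by rewrite tofrac_eq0 expf_neq0.
  by apply: (mulIf an); rewrite mulrC [RHS]mulrC -E; ring.
apply: prodI_ind.
- by exists 1, 0; split; [exact: prime_1|exact: submod0|rewrite !mulr0].
- move=> u v [t [c1 [nt I1 E]]] [t' [c2 [nt' I2 E']]].
  exists (t * t'), (t'%:F * c1 + t%:F * c2); split; first exact: prime_mul.
    by apply: submodD; [|apply: submodM|apply: submodM].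
  have -> : (t * t')%:F * (u + v) = t'%:F * (t%:F * u) + t%:F * (t'%:F * v) by ring.
  by rewrite E E'; ring.
- move=> j d Jj /divn[t [r [nt E]]]; exists t, (r%:F * j); split=> //.
    exact: submodM.
  by rewrite mulrCA E tofracM; ring.
Qed.

(** * If all ideals are w-basic, then elements are comparable *)

Lemma mem_img_gen (s : seq R) f : f \in s -> gen [seq f%:F | f <- s] f%:F.
Proof. by move=> fs; apply/mem_gen/map_f. Qed.

Lemma gen_mul (s : seq R) N : submod N ->
  (forall f g, f \in s -> g \in s -> N (f%:F * g%:F)) ->
  forall x y, gen [seq f%:F | f <- s] x -> gen [seq f%:F | f <- s] y -> N (x * y).
Proof.
move=> sN h x y /genE hx /genE hy; apply: (hy _ (submod_colonl x sN)).
move=> _ /mapP[g gs ->]; rewrite mulrC.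
apply: (hx _ (submod_colonl g%:F sN)) => _ /mapP[f fs ->]; exact: h.
Qed.

Lemma int_ideal_gen (s : seq R) : int_ideal (gen [seq f%:F | f <- s]).
Proof. by split; [apply: submod_gen|case: (fg_ideal_gen s)]. Qed.

Definition all_w_basic := forall I, int_ideal I -> nonzero I -> w_basic I.

(** The equation puts b^2 in a(a, b), so (a) is a w-reduction of (a, b) and b lies in (a)_w.
    Principal ideals are w-closed: a [gv] sequence sends b/a into R, so b/a is in R. *)
Lemma w_basic_int_closed a b p q : all_w_basic -> a != 0 ->
  b ^+ 2 = p * (a * b) + q * a ^+ 2 -> exists r, b = a * r.
Proof.
move=> hB a0 E; set I := gen [seq f%:F | f <- [:: a; b]].
set J := gen [seq f%:F | f <- [:: a]].
have iI : int_ideal I by apply: int_ideal_gen.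
have iJ : int_ideal J by apply: int_ideal_gen.
have [[sI _] [sJ _]] := (iI, iJ).
have Ia : I a%:F by apply: mem_img_gen; rewrite inE eqxx.
have Ib : I b%:F by apply: mem_img_gen; rewrite !inE eqxx orbT.
have Ja : J a%:F by apply: mem_img_gen; rewrite inE.
have sP : submod (prodI J I) by apply: submod_prodI.
have red : w_reduction J I.
  apply: w_reductionI => //.
    by move=> x /genE; apply=> // _ /mapP[f + ->]; rewrite inE => /eqP ->.
  move=> x y hx hy; apply: sub_wop => //; apply: gen_mul x y hx hy => // f g.
  rewrite !inE => /orP[] /eqP -> /orP[] /eqP ->; try exact: prodI_mul.
    by rewrite mulrC; apply: prodI_mul.
  rewrite -tofracM -expr2 E tofracD tofracM; apply: submodD => //.
    by apply: submodM => //; rewrite tofracM; apply: prodI_mul.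
  by rewrite tofracM; apply: submodM => //; rewrite expr2 tofracM; apply: prodI_mul.
have nI : nonzero I by exists a%:F; rewrite tofrac_eq0.
have /(wopP _ sJ)[s [hs gs]] := (hB I iI nI J red _).2 (sub_wop sI Ib).
have aF : a%:F != 0 by rewrite tofrac_eq0.
have [|r Er] := gs (b%:F / a%:F); last first.
  by exists r; apply: FI; rewrite tofracM -Er mulrC divfK.
move=> f /hs; rewrite /colonr => /genE /(_ _ (submod_colonl a%:F^-1 submod_inR)) h.
have -> : b%:F / a%:F * f%:F = a%:F^-1 * (f%:F * b%:F) by ring.
apply: h => _ /mapP[g + ->].
by rewrite inE => /eqP ->; rewrite mulVf // -tofrac1.
Qed.

Lemma w_basic_compar : all_w_basic -> compar.
Proof.
move=> hB a b; have [a0|a0] := eqVneq a 0.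
  apply: dense1; exists 0, 1; rewrite add0r; split=> //; exists 0; rewrite ?a0; ring.
set I := gen [seq f%:F | f <- [:: a ^+ 2; a * b; b ^+ 2]].
set J := gen [seq f%:F | f <- [:: a ^+ 2; b ^+ 2]].
have iI : int_ideal I by apply: int_ideal_gen.
have iJ : int_ideal J by apply: int_ideal_gen.
have [[sI _] [sJ _]] := (iI, iJ).
have Ia : I (a ^+ 2)%:F by apply: mem_img_gen; rewrite inE eqxx.
have Iab : I (a * b)%:F by apply: mem_img_gen; rewrite !inE eqxx orbT.
have Ib : I (b ^+ 2)%:F by apply: mem_img_gen; rewrite !inE eqxx !orbT.
have Ja : J (a ^+ 2)%:F by apply: mem_img_gen; rewrite inE eqxx.
have Jb : J (b ^+ 2)%:F by apply: mem_img_gen; rewrite !inE eqxx orbT.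
have sP : submod (prodI J I) by apply: submod_prodI.
have red : w_reduction J I.
  apply: w_reductionI => //.
    by move=> x /genE; apply=> // _ /mapP[f + ->]; rewrite !inE => /orP[] /eqP ->.
  move=> x y hx hy; apply: sub_wop => //; apply: gen_mul x y hx hy => // f g.
  rewrite !inE => /or3P[] /eqP -> /or3P[] /eqP ->; try exact: prodI_mul;
    try by [rewrite mulrC; apply: prodI_mul].
  have -> : (a * b)%:F * (a * b)%:F = (a ^+ 2)%:F * (b ^+ 2)%:F by ring.
  exact: prodI_mul.
have nI : nonzero I by exists (a ^+ 2)%:F; rewrite tofrac_eq0 expf_neq0.
have /(wopP _ sJ) := (hB I iI nI J red _).2 (sub_wop sI Iab).
apply: dense_sub => f.
have iS : ideal (fun g : R => exists r t, g = r * a ^+ 2 + t * b ^+ 2).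
  split; first by exists 0, 0; ring.
    by move=> _ _ [r [t ->]] [r' [t' ->]]; exists (r + r'), (t + t'); ring.
  by move=> u _ [r [t ->]]; exists (u * r), (u * t); ring.
rewrite /colonr -tofracM => /genE /(_ _ (submod_image iS)) [].
  move=> _ /mapP[g + ->]; rewrite !inE => /orP[] /eqP ->; eexists; try by [].
    by exists 1, 0; ring.
  by exists 0, 1; ring.
move=> _ /FI <- [r [t E]].
(* Multiplying fab = ra^2 + tb^2 by t gives (tb)^2 = f a(tb) - tr a^2, whence tb = au. Then f - u is
   in D(a,b) and u in D(b,a). *)
have [||u Eu] := @w_basic_int_closed a (t * b) f (- (t * r)) hB => //.
  have -> : (t * b) ^+ 2 = t * (r * a ^+ 2 + t * b ^+ 2) - t * r * a ^+ 2 by ring.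
  by rewrite -E; ring.
exists (f - u), u; split; last by ring.
  exists r; apply: (mulfI a0); have -> : a * ((f - u) * b) = f * (a * b) - (a * u) * b by ring.
  by rewrite E -Eu; ring.
by exists t; rewrite mulrC -Eu mulrC.
Qed.

(** * If all ideals are w-basic, then maximal t-ideals have height one *)

(** In the valuation domain R_M an element outside the prime Q divides every element of Q; otherwise
    ts would be a multiple of e, hence in Q, with t and s both outside Q. *)
Lemma loc_prime M Q s e : compar -> prime_ideal M -> ~ dense (trace M) ->
  prime_ideal Q -> subs Q M -> ~ Q s%:F -> Q e%:F -> loc M s e.
Proof.
move=> hC [[sM _] _ _] dM prQ QM ns Qe; have [[sQ _] _ _] := prQ.
have [t [nt [[n E]|[n E]]]] := compar_out s e hC sM dM; first by exists t, n.
have ntQ : ~ Q t%:F by move/QM.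
case: (prime_mul prQ ntQ ns); rewrite E mulrC tofracM; exact: submodM.
Qed.

(* In a valuation domain with primes [Q] inside [M] and [q] in [Q], this is the inclusion of
   [J = (q)] in [I = q V_Q], for which [I ^+ 2 = q ^+ 2 V_Q = J I]. *)
Lemma loc_w_reduction M Q q : compar -> prime_ideal M -> ~ dense (trace M) ->
  prime_ideal Q -> subs Q M -> Q q%:F -> q != 0 ->
  w_reduction (img (loc M q)) (img (loc Q q)).
Proof.
move=> hC prM dM prQ QM Qq q0; have [[sQ QR] _ pQ] := prQ.
have QIJ (e x : R) : Q e%:F -> loc Q q x -> loc M q (e * x).
  move=> Qe [s [u [ns E]]]; have [t [n [nt E']]] := loc_prime hC prM dM prQ QM ns Qe.
  exists t, (u * n); split=> //.
  by rewrite mulrA E' mulrAC E mulrA.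
have iI := int_ideal_img (ideal_loc q prQ); have iJ := int_ideal_img (ideal_loc q prM).
set I := img (loc Q q) in iI; set J := img (loc M q) in iJ.
have [[sI _] [sJ _]] := (iI, iJ).
have sP : submod (prodI J I) by apply: submod_prodI.
apply: w_reductionI => //.
  by move=> _ [r -> [t [u [nt E]]]]; apply/imgE; exists t, u; split=> //; move/QM.
move=> _ _ [x -> Ix] [y -> Iy]; apply/wopP => //.
have iA := ideal_colonr (x%:F * y%:F) sP; set A := colonr _ _ in iA *.
have AE (e m n : R) : loc M q m -> loc Q q n -> e * (x * y) = m * n -> A e.
  move=> Jm In E; rewrite /A /colonr -!tofracM E tofracM.
  by apply: prodI_mul; apply/imgE.
have Jq u : loc M q (q * u) by exists 1, u; rewrite mul1r; split=> //; exact: prime_1.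
have AQ v : Q v%:F -> A v.
  by move=> Qv; apply: AE (QIJ _ _ Qv Ix) Iy _; ring.
have [x00|x00] := eqVneq x 0.
  apply: dense1; apply: AE (Jq 0) Iy _; rewrite x00; ring.
have [s [r0 [ns Es]]] := Ix; have [s' [r1 [ns' Es']]] := Iy.
(* If q divides x locally, then x is in J and xy in JI. Otherwise vq = xz; for v outside Q this
   forces z outside Q as well. *)
apply: (dense_sumi iA (hC q x)) => [u [w Ew]|v [z Ez]].
  by apply: dense_mul_closed => //; apply: AE (Jq w) Iy _; rewrite mulrA Ew.
have [Qv|nv] := EM (Q v%:F); first by apply: dense_mul_closed => //; exact: AQ.
have svz : s * v = r0 * z.
  apply: (mulfI x00); have -> : x * (s * v) = v * (s * x) by ring.
  by rewrite Es mulrA Ez; ring.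
have nz : ~ Q z%:F.
  by move=> Qz; apply: (prime_mul prQ ns nv); rewrite svz tofracM; apply: submodM.
(* If uy = zw, then w is in I because z is outside Q, and uvxy = (qv^2)w is in JI. If uz = yw, then
   uv falls in Q, which [AQ] covers. *)
apply: (dense_sumi (ideal_mulr v iA) (hC z y)) => [u [w Ew]|u [w Ew]]; apply: dense1; rewrite mul1r.
  apply: (AE _ (q * (v * v)) w) => //.
    exists (s' * z), (u * r1); split; first exact: prime_mul.
    by rewrite -mulrA -Ew mulrCA Es' mulrCA.
  have -> : u * v * (x * y) = v * x * (u * y) by ring.
  rewrite Ew; have -> : v * x * (z * w) = v * (x * z) * w by ring.
  by rewrite -Ez; ring.
apply: AQ; apply: contrapT => nuv.
apply: (prime_mul prQ (prime_mul prQ ns ns') nuv).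
have -> : s * s' * (u * v) = (r0 * r1 * w) * q.
  apply: (mulfI q0); have -> : q * (s * s' * (u * v)) = s * s' * u * (v * q) by ring.
  rewrite Ez; have -> : s * s' * u * (x * z) = (s * x) * s' * (u * z) by ring.
  rewrite Ew Es; have -> : q * r0 * s' * (y * w) = q * r0 * (s' * y) * w by ring.
  by rewrite Es'; ring.
by rewrite tofracM; apply: submodM.
Qed.

Lemma w_basic_t_dim_one : all_w_basic -> t_dim_one R.
Proof.
move=> hB M mM; have hC := w_basic_compar hB.
have prM := maximal_t_prime mM; have [iM pM tM _] := mM.
have [sM MR] := iM; have dM := t_ideal_nondense iM pM tM.
have nM := t_ideal_nonzero sM tM; split=> // Q prQ [x0 [Qx0 nx0]] QM.
have [[sQ QR] _ pQ] := prQ.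
have [q Eq] := QR _ Qx0; subst x0; rename Qx0 into Qq.
have q0 : q != 0 by rewrite -tofrac_eq0.
move=> x; split; first exact: QM.
move=> Mx; have [a Ea] := MR _ Mx; subst x; rename Mx into Ma.
apply: contrapT => nQa.
have iI := int_ideal_img (ideal_loc q prQ); have iJ := int_ideal_img (ideal_loc q prM).
set I := img (loc Q q) in iI; set J := img (loc M q) in iJ.
have [[sI _] [sJ _]] := (iI, iJ).
have red : w_reduction J I by apply: loc_w_reduction.
have Iq : I q%:F by apply/imgE; exists 1, 1; split; [exact: prime_1|ring].
have nI : nonzero I by exists q%:F.
(* Up to a unit of R_M, z is q/a. It lies in qR_Q since a is outside Q, but not in qR_M since a is
   in M, which separates I from J_w. *)
have [t [z [nt Etz]]] := loc_prime hC prM dM prQ QM nQa Qq.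
have Iz : I z%:F by apply/imgE; exists a, t; split=> //; rewrite -Etz mulrC.
have /(wopP _ sJ) dz := (hB I iI nI J red _).2 (sub_wop sI Iz).
have [f [+ nf]] := dense_out dz dM.
rewrite /colonr -tofracM => /imgE[s [u [ns E]]].
apply: (prime_mul prM (prime_mul prM ns nf) nt).
have -> : s * f * t = u * a; last by rewrite tofracM; apply: submodM.
apply: (mulfI q0); have -> : q * (s * f * t) = s * f * (t * q) by ring.
rewrite Etz; have -> : s * f * (a * z) = a * (s * (f * z)) by ring.
by rewrite E; ring.
Qed.

End PvMD.

Theorem theorem2p4 (R : idomainType) :
  (forall I : fset R, int_ideal I -> nonzero I -> w_basic I) <->
  (PvMD R /\ t_dim_one R).
Proof.
split=> [hB|[hP hT] I iI _].
  split; last exact: w_basic_t_dim_one.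
  exact/compar_PvMD/w_basic_compar.
exact: w_basic_of_PvMD (PvMD_compar hP) hT iI.
Qed.
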